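(* Let $M\ge1$, let $\mathcal F$ be any family of $M$-tuples of continuous vector fields, and let $\mathcal V=\bigcup_n\mathcal V_n$ be any template closed under composition with the dynamics of $\mathcal F$. Then the composition lift is valid with respect to $\mathcal V$ and $\mathcal F$: for every path-complete graph $\mathcal G$ on $\langle M\rangle$ satisfying the standing assumption, $\mathcal G\le_{\mathcal V,\mathcal F}\mathcal G_{\mathrm{co}}$.
   Context: Graphs. $\langle M\rangle:=\{1,\dots,M\}$. A graph on $\langle M\rangle$ is a pair $\mathcal G=(S,E)$ with $S$ a finite nonempty set of nodes and $E\subseteq S\times S\times\langle M\rangle$ a set of directed labeled edges. $\mathcal G$ is path-complete if for every $K\ge1$ and every $(j_1,\dots,j_K)\in\langle M\rangle^K$ there are nodes $a_1,\dots,a_{K+1}$ with $(a_k,a_{k+1},j_k)\in E$ for $1\le k\le K$. Standing assumption on the graph $\mathcal G$ being lifted: $\mathcal G$ has one strongly connected component (it is strongly connected), and removing any edge from $\mathcal G$ destroys path-completeness. (The lifted graph is not required to satisfy this.) Templates. $\mathcal C^0_+(\mathbb R^n,\mathbb R)$ is the set of continuous, positive definite, radially unbounded functions $\mathbb R^n\to\mathbb R$. A template is a family $\mathcal V=\bigcup_{n\ge1}\mathcal V_n$ with $\mathcal V_n\subseteq\mathcal C^0_+(\mathbb R^n,\mathbb R)$. Each element of $\mathcal F$ is an $M$-tuple $F=(f_1,\dots,f_M)$ of continuous maps $\mathbb R^n\to\mathbb R^n$ for some $n$ (depending on $F$). $\mathcal V$ is closed under composition with the dynamics of $\mathcal F$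 if for every $n$, every $V\in\mathcal V_n$ and every map $f:\mathbb R^n\to\mathbb R^n$ that is an entry of some tuple in $\mathcal F$, one has $V\circ f\in\mathcal V_n$. Order relation. For $F=(f_1,\dots,f_M)$ on $\mathbb R^n$ and a path-complete graph $\mathcal G=(S,E)$, a collection $V=\{V_s\mid s\in S\}\subseteq\mathcal C^0_+(\mathbb R^n,\mathbb R)$ (indexed by $S$, repetitions allowed) is in $PCLF(\mathcal G,F)$ if $V_b(f_i(x))\le V_a(x)$ for all $(a,b,i)\in E$ and $x\in\mathbb R^n$. For path-complete graphs $\mathcal G,\widetilde{\mathcal G}$ on $\langle M\rangle$, $\mathcal G\le_{\mathcal V,\mathcal F}\widetilde{\mathcal G}$ means: for every $F\in\mathcal F$, if there is $V\subseteq\mathcal V$ with $V\in PCLF(\mathcal G,F)$, then there is $W\subseteq\mathcal V$ with $W\in PCLF(\widetilde{\mathcal G},F)$. In particular the relation includes that both graphs are path-complete. Composition lift. For $\mathcal G=(S,E)$ on $\langle M\rangle$, $\mathcal G_{\mathrm{co}}=(S_{\mathrm{co}},E_{\mathrm{co}})$ has node set $S_{\mathrm{co}}=\{s\circ i\mid s\in S,\ i\in\langle M\rangle\}$, where $s\circ i$ is a formal symbol (a pair $(s,i)$), and edge set $E_{\mathrm{co}}=\{(a\circ j,\ b\circ i,\ j)\mid (a,b,i)\in E,\ j\in\langle M\rangle\}$. *)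

(* Defs.v *)
From HB Require Import structures.
From mathcomp Require Import all_boot all_order all_algebra.
From mathcomp Require Import classical_sets reals topology normedtype.

Set Implicit Arguments.
Unset Strict Implicit.
Unset Printing Implicit Defensive.

Import Order.TTheory GRing.Theory Num.Theory.
Import numFieldNormedType.Exports.

Local Open Scope ring_scope.

(* Labels <M> = {1, ..., M} are represented by 'I_M = {0, ..., M - 1}. *)
Record lgraph (M : nat) := LGraph {
  node : finType;
  node_gt0 : (0 < #|node|)%N;
  edge : {set node * node * 'I_M}
}.

Definition path_complete (M : nat) (G : lgraph M) : Prop :=
  forall K : nat, (1 <= K)%N -> forall j : 'I_K -> 'I_M,
  exists a : 'I_K.+1 -> node G,
  forall k : 'I_K,
    (a (widen_ord (leqnSn K) k), a (lift ord0 k), j k) \in edge G.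

Definition strongly_connected (M : nat) (G : lgraph M) : Prop :=
  forall a b : node G,
    connect [rel x y | [exists i : 'I_M, (x, y, i) \in edge G]] a b.

Definition remove_edge (M : nat) (G : lgraph M)
    (e : node G * node G * 'I_M) : lgraph M :=
  LGraph (node_gt0 G) (edge G :\ e)%SET.

Definition standing_assumption (M : nat) (G : lgraph M) : Prop :=
  strongly_connected G /\
  forall e, e \in edge G -> ~ path_complete (remove_edge e).

Lemma co_node_gt0 (M : nat) (M_gt0 : (0 < M)%N) (G : lgraph M) :
  (0 < #|{: node G * 'I_M}|)%N.
Proof. by rewrite card_prod card_ord muln_gt0 node_gt0 M_gt0. Qed.

(* The formal symbol s o i is the pair (s, i): an edge e = (a, b, i) and a
   label j give the edge (a o j, b o i, j). *)
Definition co_lift (M : nat) (M_gt0 : (0 < M)%N) (G : lgraph M) : lgraph M :=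
  LGraph (co_node_gt0 M_gt0 G)
    [set ((e.1.1, j), (e.1.2, e.2), j) | e in edge G, j in [set: 'I_M]]%SET.

(* Only dimensions >= 1 occur: in what follows, index n stands for the state
   space of dimension n + 1. *)
Notation state R n := 'cV[R]_n.+1.

(* `|x| is the sup norm; all norms on R^n being equivalent, radial
   unboundedness does not depend on this choice. *)
Definition C0plus (R : realType) (n : nat) : set (state R n -> R) :=
  fun V => [/\ continuous V,
    V 0 = 0 /\ (forall x, x != 0 -> 0 < V x) &
    forall A : R, exists r : R, forall x, r <= `|x| -> A <= V x].

Definition template (R : realType) (T : forall n, set (state R n -> R)) :
    Prop :=
  forall n V, T n V -> C0plus V.

(* A set of M-tuples of self-maps of R^d for varying d, sorted by d. *)
Definition tuple_family (R : realType) (M : nat) :=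
  forall n, set ('I_M -> state R n -> state R n).

Definition continuous_family (R : realType) (M : nat)
    (Fam : tuple_family R M) : Prop :=
  forall n F, Fam n F -> forall i, continuous (F i).

Definition closed_under_composition (R : realType) (M : nat)
    (T : forall n, set (state R n -> R)) (Fam : tuple_family R M) : Prop :=
  forall n V f, T n V -> (exists F, Fam n F /\ exists i, f = F i) ->
  T n (V \o f).

Definition PCLF (R : realType) (M : nat) (G : lgraph M) (n : nat)
    (F : 'I_M -> state R n -> state R n) : set (node G -> state R n -> R) :=
  fun V => (forall s, C0plus (V s)) /\
    forall a b i, (a, b, i) \in edge G -> forall x, V b (F i x) <= V a x.
Arguments PCLF {R M} G {n} F V.

Definition graph_le (R : realType) (M : nat)
    (T : forall n, set (state R n -> R)) (Fam : tuple_family R M)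
    (G G' : lgraph M) : Prop :=
  [/\ path_complete G, path_complete G' &
    forall n F, Fam n F ->
      (exists V, (forall s, T n (V s)) /\ PCLF G F V) ->
      exists W, (forall s, T n (W s)) /\ PCLF G' F W].

Definition valid_lift (R : realType) (M : nat)
    (T : forall n, set (state R n -> R)) (Fam : tuple_family R M)
    (L : lgraph M -> lgraph M) : Prop :=
  forall G, path_complete G -> standing_assumption G -> graph_le T Fam G (L G).

(* Main.v *)
Require Import Defs.
From mathcomp Require Import all_boot all_order all_algebra.
From mathcomp Require Import classical_sets reals topology normedtype.

(** An edge [(a, b, i)] and a label [j] of the lift ask for
    [W (b, i) (f_j x) <= W (a, j) x]; with [W (s, i) := V s \o f_i] this is the
    inequality of [(a, b, i)] at the point [f_j x]. A path of the lift reading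
    [j_1 ... j_K] comes from a path of the graph reading the shifted word
    [j_2 ... j_K j'], with [j'] arbitrary. *)

Lemma mem_co_lift (M : nat) (M_gt0 : (0 < M)%N) (G : lgraph M)
    (a b : node G) (i l j : 'I_M) :
  (((a, l), (b, i), j) \in edge (co_lift M_gt0 G)) =
  ((a, b, i) \in edge G) && (l == j).
Proof.
apply/imset2P/andP => [[[[a' b'] i'] j' Ee _ [-> -> -> -> ->]] | [Ee /eqP ->]].
  by split.
by exists (a, b, i) j; rewrite ?inE.
Qed.

Lemma co_lift_path_complete (M : nat) (M_gt0 : (0 < M)%N) (G : lgraph M) :
  path_complete G -> path_complete (co_lift M_gt0 G).
Proof.
move=> pcG [//|K] _ j.
(* Past the end of the word [inord] defaults to [ord0], so the arbitrary last letter [j'] of the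
   shifted word is [j ord0]. *)
pose J k : 'I_M := j (inord k).
have [a aP] := pcG K.+1 isT (fun k => J k.+1).
(* An edge of the lift carries the second component of its tail as label, so node [k] has to hold
   letter [k]. *)
exists (fun k => (a k, J k)) => k.
by rewrite mem_co_lift aP /= /J inord_val eqxx.
Qed.

Theorem theorem4 (R : realType) (M : nat) (M_gt0 : (0 < M)%N)
  (Fam : tuple_family R M) (Fam_continuous : continuous_family Fam)
  (T : forall n : nat, set (state R n -> R)) (T_template : template T)
  (T_closed : closed_under_composition T Fam) :
  valid_lift T Fam (co_lift M_gt0).
Proof.
move=> G pcG _; split=> //; first exact: co_lift_path_complete.
move=> n F FamF [V [TV [_ VP]]].
have TW s : T n (V s.1 \o F s.2).
  by apply: T_closed => //; exists F; split=> //; exists s.2.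
exists (fun s => V s.1 \o F s.2); split=> //; split=> [s|].
  (* Positive definiteness and radial unboundedness may be lost under composition with [F i]; here
     they come from membership in [T]. *)
  exact: T_template.
by move=> [a l] [b i] j; rewrite mem_co_lift => /andP[Ee /eqP ->] x; exact: VP.
Qed.
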